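(* Let $d\geq 2$ and $n\geq 2$ be integers, let $E\subseteq\mathbb{R}^d$ be a Lebesgue-measurable set with upper Banach density $\rho(E)>\frac{n-1}{n}$, and let $P\subseteq\mathbb{R}^d$ be a set of exactly $n$ points. Then for every $r>0$ the set $E$ contains a translated copy of $rP$, i.e. there exists $z\in\mathbb{R}^d$ with $rP+z\subseteq E$.
   Context: The upper Banach density of a measurable set $E\subseteq\mathbb{R}^d$ is $$\rho(E)=\limsup_{r\to+\infty}\ \sup_{x\in\mathbb{R}^d}\frac{\mathcal{L}^d(E\cap B_r(x))}{\mathcal{L}^d(B_r(x))},$$ where $\mathcal{L}^d$ is Lebesgue measure and $B_r(x)$ is the closed ball of centre $x$ and radius $r$. *)

(* Defs.v *)
From HB Require Import structures.
From mathcomp Require Import all_boot all_order all_algebra.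
From mathcomp Require Import all_classical all_reals all_analysis.

Set Implicit Arguments.
Unset Strict Implicit.
Unset Printing Implicit Defensive.

Import Order.TTheory GRing.Theory Num.Theory.
Import numFieldNormedType.Exports.

Local Open Scope classical_set_scope.
Local Open Scope ring_scope.

Definition box (R : realType) (d : nat) (c : 'rV[R]_d * 'rV[R]_d)
  : set 'rV[R]_d :=
  [set x | forall i, c.1 ord0 i <= x ord0 i <= c.2 ord0 i].

(* The maximum with 0 gives volume 0 to the empty boxes, in which some lower
   bound exceeds the corresponding upper bound. *)
Definition box_volume (R : realType) (d : nat) (c : 'rV[R]_d * 'rV[R]_d) : R :=
  \prod_(i < d) Num.max 0 (c.2 ord0 i - c.1 ord0 i).

(* mathcomp-analysis has the Lebesgue measure on R only.  On R^d we take the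
   Lebesgue outer measure: the infimum of the total volumes of the countable
   covers by boxes.  Its restriction to the Lebesgue-measurable sets is the
   d-dimensional Lebesgue measure. *)
Definition lebesgue_outer (R : realType) (d : nat) (A : set 'rV[R]_d) : \bar R :=
  ereal_inf [set (\sum_(k <oo) (box_volume (c k))%:E)%E
            | c in [set c : ('rV[R]_d * 'rV[R]_d)^nat
                   | A `<=` \bigcup_k box (c k)]].

Section lebesgue_outer_measure.
Context (R : realType) (d : nat).
Local Notation mu := (@lebesgue_outer R d).
Local Open Scope ereal_scope.

Lemma box_volume_ge0 (c : 'rV[R]_d * 'rV[R]_d) : (0 <= box_volume c)%R.
Proof. by apply: prodr_ge0 => i _; rewrite le_max lexx. Qed.

Lemma lebesgue_outer_ge0 A : 0 <= mu A.
Proof.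
apply: le_ereal_inf_tmp => _ [c _ <-].
by apply: nneseries_ge0 => n _ _; rewrite lee_fin box_volume_ge0.
Qed.

Lemma le_lebesgue_outer : {homo mu : A B / A `<=` B >-> A <= B}.
Proof.
move=> A B AB; apply/ereal_inf_le_tmp => _ [c Bc <-].
by exists c => //; exact: subset_trans AB Bc.
Qed.

Lemma lebesgue_outer0 : (0 < d)%N -> mu set0 = 0.
Proof.
move=> d0; apply/eqP; rewrite eq_le lebesgue_outer_ge0 andbT.
apply: ereal_inf_lbound; exists (fun=> (0, 0)%R) => //.
rewrite eseries0// => n _ _; rewrite /box_volume (bigD1 (Ordinal d0))//=.
by rewrite subrr maxxx mul0r.
Qed.

Lemma lebesgue_outer_sigma_subadditive : sigma_subadditive mu.
Proof.
move=> A; have [[i ioo]|] := pselect (exists i, mu (A i) = +oo).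
  rewrite (eseries_pinfty _ _ ioo) ?leey// => n _.
  by rewrite -ltNye (lt_le_trans _ (lebesgue_outer_ge0 _)).
rewrite -forallNE => Aoo.
suff add2e (e : {posnum R}) :
    mu (\bigcup_n A n) <= \sum_(i <oo) mu (A i) + e%:num%:E.
  by apply/lee_addgt0Pr => _/posnumP[].
rewrite (le_trans _ (epsilon_trick _ _ _))//; last first.
  by move=> n; exact: lebesgue_outer_ge0.
pose vol c : \bar R := (@box_volume R d c)%:E.
have vol0 c : 0 <= vol c by rewrite lee_fin box_volume_ge0.
have [G PG] : {G : nat -> ('rV[R]_d * 'rV[R]_d)^nat & forall n,
    A n `<=` \bigcup_k box (G n k) /\
    \sum_(k <oo) vol (G n k) <= mu (A n) + (e%:num / (2 ^ n.+1)%:R)%:E}.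
  apply: (@choice _ _ (fun n c => A n `<=` \bigcup_k box (c k) /\
    \sum_(k <oo) vol (c k) <= mu (A n) + (e%:num / (2 ^ n.+1)%:R)%:E)) => n.
  have Anfin : mu (A n) \is a fin_num.
    by rewrite ge0_fin_numE ?lebesgue_outer_ge0// ltey; apply/eqP/Aoo.
  have en1 : (0 < e%:num / (2 ^ n.+1)%:R)%R by [].
  have [_ [c Ac <-] ltc] := lb_ereal_inf_adherent en1 Anfin.
  by exists c; split => //; exact: ltW.
have volG_ge0 x : 0 <= (vol \o uncurry G) x by exact: vol0.
apply: (@le_trans _ _ (\esum_(i in setT) (vol \o uncurry G) i)).
  apply: ereal_inf_lbound => /=.
  have /card_esym/ppcard_eqP[f] := card_nat2.
  exists (uncurry G \o f).
    move=> t [n _ /(PG n).1 [k _ tk]]; exists (f^-1%FUN (n, k)) => //=.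
    by rewrite invK ?inE.
  rewrite -(esum_pred_image (vol \o uncurry G) _ xpredT) ?[fun=> _]set_true//.
  by rewrite image_eq.
rewrite (_ : esum _ _ = \sum_(i <oo) \sum_(j <oo) vol (G i j)).
  apply: lee_nneseries => [n _ _|n _]; last exact: (PG n).2.
  by apply: nneseries_ge0 => m *; exact: vol0.
pose J : nat -> set (nat * nat) := fun i => [set (i, j) | j in setT].
rewrite (_ : setT = \bigcup_k J k); last first.
  by rewrite predeqE => -[a b]; split => // _; exists a => //; exists b.
rewrite esum_bigcupT /=; last 2 first.
- apply/trivIsetP => i j _ _ ij.
  rewrite predeqE => -[n m] /=; split => //= -[] [_] _ [<-{n} _].
  by move=> [m' _] [] /esym/eqP; rewrite (negbTE ij).
- by move=> /= [n m]; exact: vol0.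
rewrite -(image_id [set: nat]) -fun_true esum_pred_image//; last first.
  by move=> n _; exact: esum_ge0.
apply: eq_eseriesr => /= j _.
rewrite -(esum_pred_image (vol \o uncurry G) (pair j) predT)//=; last first.
  by move=> ? ? _ _; exact: (@can_inj _ _ _ snd).
by congr esum; rewrite predeqE => -[a b]; split; move=> [i _ <-]; exists i.
Qed.

End lebesgue_outer_measure.

(* In dimension 0 no box is empty and lebesgue_outer set0 is infinite. *)
HB.instance Definition _ (R : realType) (d : nat) :=
  isOuterMeasure.Build R 'rV[R]_d.+1 (@lebesgue_outer R d.+1)
    (lebesgue_outer0 R (ltn0Sn d)) (@lebesgue_outer_ge0 R d.+1)
    (@le_lebesgue_outer R d.+1) (@lebesgue_outer_sigma_subadditive R d.+1).

Definition lebesgue_measurable (R : realType) (d : nat) (E : set 'rV[R]_d) :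
  Prop := (@lebesgue_outer R d).-caratheodory E.

(* The library norm on 'rV[R]_d is the sup norm, so that its balls are cubes;
   these are the Euclidean balls. *)
Definition closed_eball (R : realType) (d : nat) (x : 'rV[R]_d) (r : R) :
    set 'rV[R]_d :=
  [set y | Num.sqrt (\sum_(i < d) (y ord0 i - x ord0 i) ^+ 2) <= r].

Definition upper_banach_density (R : realType) (d : nat) (E : set 'rV[R]_d) :
    \bar R :=
  limf_esup (fun r : R =>
    ereal_sup [set (lebesgue_outer (E `&` closed_eball x r) /
                    lebesgue_outer (closed_eball x r))%E | x in [set: 'rV[R]_d]])
    (+oo_R).

(* Main.v *)
Require Import Defs.
From mathcomp Require Import all_boot all_order all_algebra.
From mathcomp Require Import all_classical all_reals all_analysis.
From mathcomp Require Import ring lra.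

Import Order.TTheory GRing.Theory Num.Theory.
Import numFieldNormedType.Exports.

Local Open Scope classical_set_scope.
Local Open Scope ring_scope.

(** Suppose that no translate of [r P] lies in [E].  Then each point [z] is moved
    out of [E] by one of the [n] vectors [v = r p], so the [n] translates of the
    complement of [E] by the vectors [- v] cover the whole space.  If all these
    vectors have length at most [M], then looking inside a ball of radius
    [s - M] gives
      mu (B_(s - M)) <= n * mu (B_s \ E),
    because a translation by [v] sends the smaller ball into the concentric ball
    of radius [s] ([lebesgue_outer_eball_le_setD]).  By homogeneity the left-hand
    side is [(1 - M / s) ^ d * mu (B_s)], and Bernoulli's inequality bounds this
    from below by [(1 - d M / s) * mu (B_s)] ([lebesgue_outer_eball_scale],
    [bernoulli_ineq]).  Hence the complement of [E] fills at least the
    proportion [(1 - d M / s) / n] of every ball of radius [s > M] and, [E] being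
    measurable, [E] itself fills at most [1 - (1 - d M / s) / n]
    ([lebesgue_outer_density_le]).  This bound is uniform in the centre of the
    ball and tends to [(n - 1) / n] as [s] goes to infinity, which contradicts
    the hypothesis on the density. *)

(** * Lebesgue outer measure and affine maps *)

(** A dilation by [t] followed by a translation sends boxes to boxes and
    multiplies their volumes by [t ^ d], so the image of a cover of [A] covers
    the image of [A]. *)
Lemma lebesgue_outer_affine (R : realType) (d : nat) (t : R) (v : 'rV[R]_d)
    (A : set 'rV[R]_d) : 0 < t ->
  (lebesgue_outer [set (t *: x + v)%R | x in A] <=
   (t ^+ d)%:E * lebesgue_outer A)%E.
Proof.
move=> t0; have td0 : 0 < t ^+ d by rewrite exprn_gt0.
rewrite -lee_pdivrMl//; apply: le_ereal_inf_tmp => _ [c Ac <-].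
rewrite lee_pdivrMl//; apply: ereal_inf_lbound.
exists (fun k => (t *: (c k).1 + v, t *: (c k).2 + v)).
  move=> _ [x /Ac[k _ ck] <-]; exists k => // i; rewrite /= !mxE.
  by move: (ck i) => /andP[c1 c2]; rewrite !lerD2r !ler_pM2l// c1 c2.
rewrite -nneseriesZl => [|k _]; last by rewrite lee_fin box_volume_ge0.
apply: eq_eseriesr => k _; rewrite -EFinM; congr EFin.
rewrite /box_volume -[in t ^+ d](card_ord d) -prodr_const -big_split/=.
apply: eq_bigr => i _; rewrite !mxE maxr_pMr ?ltW// mulr0.
by congr Num.max; ring.
Qed.

Lemma lebesgue_outer_shift_le (R : realType) (d : nat) (v : 'rV[R]_d)
    (A B : set 'rV[R]_d) :
  (forall x, A x -> B (x + v)) -> (lebesgue_outer A <= lebesgue_outer B)%E.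
Proof.
move=> AB; have := lebesgue_outer_affine _ _ 1 (- v) B ltr01.
rewrite expr1n mul1e; apply: le_trans; apply: le_lebesgue_outer => x Ax.
by exists (x + v); [exact: AB|rewrite scale1r addrK].
Qed.

(** * Euclidean balls *)

(** The triangle inequality.  With the weight [e = M / s], summing
    [(a + b) ^ 2 <= (1 + e) a ^ 2 + (1 + e^-1) b ^ 2] over the coordinates gives
    exactly [(s + M) ^ 2]; this choice of [e] takes the place of the
    Cauchy-Schwarz inequality. *)
Lemma closed_eballD (R : realType) (d : nat) (x y v : 'rV[R]_d) (s M : R) :
  0 < s -> 0 < M -> \sum_(i < d) v ord0 i ^+ 2 <= M ^+ 2 ->
  closed_eball x s y -> closed_eball x (s + M) (y + v).
Proof.
move=> s0 M0 vM; rewrite /closed_eball/= => ys.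
have {}ys : \sum_(i < d) (y ord0 i - x ord0 i) ^+ 2 <= s ^+ 2.
  rewrite -(ler_sqrt _ (exprn_ge0 _ (ltW s0))) sqrtr_sqr gtr0_norm//.
have sM0 : 0 < s + M by exact: addr_gt0.
rewrite -(gtr0_norm sM0) -sqrtr_sqr ler_wsqrtr//.
have -> : (s + M) ^+ 2 = (1 + M / s) * s ^+ 2 + (1 + s / M) * M ^+ 2.
  by field; rewrite !gt_eqF.
have w1 : 0 <= 1 + M / s by rewrite addr_ge0// divr_ge0// ltW.
have w2 : 0 <= 1 + s / M by rewrite addr_ge0// divr_ge0// ltW.
apply: le_trans (lerD (ler_wpM2l w1 ys) (ler_wpM2l w2 vM)).
rewrite !mulr_sumr -big_split/=; apply: ler_sum => i _; rewrite !mxE.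
set a := y _ _ - _; set b := v _ _.
have -> : y ord0 i + b - x ord0 i = a + b by rewrite /a; ring.
rewrite -subr_ge0.
have -> : (1 + M / s) * a ^+ 2 + (1 + s / M) * b ^+ 2 - (a + b) ^+ 2 =
    (M * a - s * b) ^+ 2 / (s * M) by field; rewrite !gt_eqF.
by rewrite divr_ge0 ?sqr_ge0// mulr_ge0// ltW.
Qed.

Lemma lebesgue_outer_eball_scale (R : realType) (d : nat) (x : 'rV[R]_d)
    (t s : R) : 0 < t ->
  (lebesgue_outer (closed_eball x (t * s)) <=
   (t ^+ d)%:E * lebesgue_outer (closed_eball x s))%E.
Proof.
move=> t0; have tN0 : t != 0 by rewrite gt_eqF.
apply: le_trans (lebesgue_outer_affine _ _ t (x - t *: x) _ t0).
apply: le_lebesgue_outer => y yts.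
exists (t^-1 *: (y - x) + x); last first.
  by rewrite scalerDr scalerA divff// scale1r addrACA subrK subrr addr0.
move: yts; rewrite /closed_eball/= => yts; rewrite -(ler_pM2l t0).
apply: le_trans yts; rewrite -{1}(gtr0_norm t0) -sqrtr_sqr -sqrtrM ?sqr_ge0//.
rewrite mulr_sumr ler_wsqrtr//; apply: ler_sum => i _; rewrite !mxE -exprMn.
by rewrite addrK mulrA divff// mul1r.
Qed.

(** * The complement of a set without translates of a finite configuration *)

(** The [n] translates of the complement of [E] by the vectors [- f k] cover the
    space; shifting the [k]-th piece of the smaller ball by [f k] puts it into
    the larger ball, outside [E]. *)
Lemma lebesgue_outer_eball_le_setD (R : realType) (d n : nat)
    (E : set 'rV[R]_d.+1) (f : nat -> 'rV[R]_d.+1) (x : 'rV[R]_d.+1) (s M : R) :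
  0 < s -> 0 < M ->
  (forall k, (k < n)%N -> \sum_(i < d.+1) f k ord0 i ^+ 2 <= M ^+ 2) ->
  (forall z, exists2 k, (k < n)%N & ~ E (z + f k)) ->
  (lebesgue_outer (closed_eball x s) <=
   n%:R%:E * lebesgue_outer (closed_eball x (s + M) `&` ~` E))%E.
Proof.
move=> s0 M0 fM fE.
pose F k := closed_eball x s `&` [set z | ~ E (z + f k)].
apply: (@le_trans _ _ (\sum_(k < n) lebesgue_outer (F k))%E).
  apply: (@le_trans _ _ (lebesgue_outer (\big[setU/set0]_(k < n) F k))).
    apply: le_lebesgue_outer => z zs; rewrite -bigcup_mkord.
    by have [k kn Ek] := fE z; exists k.
  exact: (outer_measure_subadditive (@lebesgue_outer R d.+1)).
rewrite mule_natl /enatmul Monoid.iteropE -big_const_ord.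
apply: lee_sum => k _; apply: (@lebesgue_outer_shift_le _ _ (f k)) => z [zs Ez].
by split => //; apply: closed_eballD => //; exact: fM.
Qed.

Lemma bernoulli_ineq (R : realFieldType) (d : nat) (u : R) : 0 <= u <= 1 ->
  1 - d%:R * u <= (1 - u) ^+ d.
Proof.
move=> /andP[u0 u1]; elim: d => [|d IH]; first by rewrite mul0r subr0.
have u1' : 0 <= 1 - u by rewrite subr_ge0.
rewrite exprS; apply: le_trans (ler_wpM2l u1' IH).
have : 0 <= d%:R * u ^+ 2 by rewrite mulr_ge0 ?sqr_ge0.
rewrite -natr1; nra.
Qed.

(** The extended-real quotient vanishes when [b] is [0], because then [a] is [0]
    as well, and when [b] is [+oo], because then its inverse is [0]; these cases
    only need the bound to be nonnegative, that is [th <= q]. *)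
Lemma lee_div_compl (R : realType) (a b c : \bar R) (q th : R) :
  (0 <= a)%E -> (0 <= c)%E -> b = (a + c)%E -> 0 < q -> th <= q ->
  (th%:E * b <= q%:E * c)%E -> (a / b <= (1 - th / q)%:E)%E.
Proof.
move=> a0 c0 bac q0 thq thb.
have w0 : 0 <= 1 - th / q by rewrite subr_ge0 ler_pdivrMr// mul1r.
have : (0 <= b)%E by rewrite bac adde_ge0.
case: b bac thb => [b||] bac thb b0; last by [].
- move: a c a0 c0 bac thb => [a||] [c||]//= a0 c0 [bac].
  rewrite -!EFinM !lee_fin in a0 c0 b0 * => thb.
  have [b_eq0|bN0] := eqVneq b 0.
    have -> : a = 0 by apply/eqP; rewrite eq_le a0 andbT -b_eq0 bac lerDl.
    by rewrite mul0e lee_fin.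
  have bp : 0 < b by rewrite lt_neqAle eq_sym bN0.
  rewrite inver (negbTE bN0) -EFinM lee_fin ler_pdivrMr//.
  rewrite -(ler_pM2l q0).
  have -> : q * ((1 - th / q) * b) = q * b - th * b by field; rewrite gt_eqF.
  by rewrite bac mulrDr -bac; lra.
- by rewrite invey mule0 lee_fin.
Qed.

(** Bernoulli's inequality is used so that the excess over [(n - 1) / n] is
    explicit and visibly tends to [0] as [s] grows; the bound does not depend on
    the centre [x]. *)
Lemma lebesgue_outer_density_le (R : realType) (d n : nat)
    (E : set 'rV[R]_d.+1) (f : nat -> 'rV[R]_d.+1) (x : 'rV[R]_d.+1) (s M : R) :
  (0 < n)%N -> lebesgue_measurable E -> 0 < M -> M < s ->
  (forall k, (k < n)%N -> \sum_(i < d.+1) f k ord0 i ^+ 2 <= M ^+ 2) ->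
  (forall z, exists2 k, (k < n)%N & ~ E (z + f k)) ->
  (lebesgue_outer (E `&` closed_eball x s) /
   lebesgue_outer (closed_eball x s) <=
   (1 - (1 - d.+1%:R * (M / s)) / n%:R)%:E)%E.
Proof.
move=> n0 mE M0 Ms fM fE; have s0 := lt_trans M0 Ms.
have sM0 : 0 < s - M by rewrite subr_gt0.
have u01 : 0 <= M / s <= 1 by rewrite divr_ge0 ?ler_pdivrMr ?mul1r ?ltW.
apply: (@lee_div_compl _ _ _ (lebesgue_outer (closed_eball x s `&` ~` E))).
- exact: lebesgue_outer_ge0.
- exact: lebesgue_outer_ge0.
- by rewrite setIC; exact: mE.
- by rewrite ltr0n.
- apply: (@le_trans _ _ 1); last by rewrite ler1n.
  by rewrite gerBl mulr_ge0//; case/andP: u01.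
have := lebesgue_outer_eball_le_setD _ _ _ _ _ x _ _ sM0 M0 fM fE.
rewrite subrK; apply: le_trans.
apply: (@le_trans _ _
    (((1 - M / s) ^+ d.+1)%:E * lebesgue_outer (closed_eball x s))%E).
  by rewrite lee_wpmul2r ?lebesgue_outer_ge0// lee_fin bernoulli_ineq.
have t0 : 0 < s / (s - M) by rewrite divr_gt0.
have := lebesgue_outer_eball_scale _ _ x _ (s - M) t0.
rewrite divfK ?gt_eqF// -lee_pdivrMl ?exprn_gt0//.
congr (_ <= _)%E; congr (_%:E * _)%E; rewrite -exprVn; congr (_ ^+ _).
by field; rewrite !gt_eqF.
Qed.

Lemma limf_esup_pinfty_le (R : realType) (g : R -> \bar R) (a : \bar R) (A : R) :
  (forall s, A < s -> (g s <= a)%E) -> (limf_esup g (+oo_R) <= a)%E.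
Proof.
move=> ga; apply: (@le_trans _ _ (ereal_sup (g @` [set s | A < s]))).
  apply: ereal_inf_lbound; exists [set s | A < s] => //.
  by exists A; split => //; exact: num_real.
by apply: ge_ereal_sup => _ [s As <-]; exact: ga.
Qed.

Theorem proposition1p3 (R : realType) (d n : nat) (hd : (2 <= d)%N)
  (hn : (2 <= n)%N) (E : set 'rV[R]_d) (mE : lebesgue_measurable E)
  (hE : (((n%:R - 1) / n%:R)%:E < upper_banach_density E)%E)
  (P : set 'rV[R]_d) (hP : (P #= `I_n)%card) (r : R) (hr : 0 < r) :
  exists z : 'rV[R]_d, [set r *: p + z | p in P] `<=` E.
Proof.
case: d hd E mE hE P hP => // d _ E mE hE P hP.
apply: contrapT => noz; move: hE; apply/negP; rewrite -leNgt.
have n0 : (0 < n)%N by exact: ltnW.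
have nR0 : 0 < n%:R :> R by rewrite ltr0n.
move: hP; rewrite card_eq_sym => /ppcard_eqP[f].
pose v k := r *: f k.
have vE z : exists2 k, (k < n)%N & ~ E (z + v k).
  apply: contrapT => zv; apply: noz; exists z => _ [p Pp <-].
  move: Pp; rewrite -(image_eq f) => -[k /= kn <-].
  by apply: contrapT => Ek; apply: zv; exists k => //; rewrite addrC.
(* As [S <= (1 + S) ^ 2] for [S >= 0], this is an upper bound for the lengths of
   all the [v k]. *)
pose S := \sum_(k < n) \sum_(i < d.+1) v k ord0 i ^+ 2.
have S0 : 0 <= S by do 2!(apply: sumr_ge0 => ? _); exact: sqr_ge0.
pose M := 1 + S; have M0 : 0 < M by rewrite ltr_wpDr.
have vM k : (k < n)%N -> \sum_(i < d.+1) v k ord0 i ^+ 2 <= M ^+ 2.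
  move=> kn; apply: (@le_trans _ _ S); last by rewrite /M; nra.
  rewrite /S (bigD1 (Ordinal kn))//= lerDl sumr_ge0// => j _.
  by rewrite sumr_ge0// => i _; exact: sqr_ge0.
apply/lee_addgt0Pr => e e0; rewrite -EFinD.
(* [K] is the radius [s] at which the excess [d M / (n s)] over the limit
   [(n - 1) / n] equals [e]. *)
pose K := d.+1%:R * M / (n%:R * e).
have K0 : 0 <= K by rewrite divr_ge0 ?mulr_ge0// ltW.
apply: (@limf_esup_pinfty_le _ _ _ (M + K)) => s MKs.
have Ms : M < s by apply: le_lt_trans MKs; rewrite lerDl.
have s0 := lt_trans M0 Ms.
apply: ge_ereal_sup => _ [x _ <-].
apply: le_trans (lebesgue_outer_density_le _ _ _ _ _ x _ _ n0 mE M0 Ms vM vE) _.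
rewrite lee_fin.
have -> : 1 - (1 - d.+1%:R * (M / s)) / n%:R =
    (n%:R - 1) / n%:R + d.+1%:R * M / n%:R / s :> R.
  by field; rewrite !gt_eqF.
rewrite lerD2l ler_pdivrMr// -ler_pdivrMl//.
apply: le_trans (ltW MKs); apply: (@le_trans _ _ K); last by rewrite lerDr ltW.
rewrite /K le_eqVlt; apply/orP; left; apply/eqP.
by field; rewrite !gt_eqF.
Qed.
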